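(* For each $(x_{k-1},u_k)$ and $\alpha>0$ let $$V_\alpha(x_{k-1},u_k)=\alpha\ln\mathbb{E}_{\bar p(\cdot\mid x_{k-1},u_k)}\Big[\Big(\frac{\bar p(X_k\mid x_{k-1},u_k)}{q(X_k\mid x_{k-1},u_k)}\Big)^{1/\alpha}\exp\Big(\frac{\bar c(X_k)}{\alpha}\Big)\Big]+\alpha\,\eta_k(x_{k-1},u_k),$$ let $M(x_{k-1},u_k)=\limsup_{x_k\in\mathrm{supp}\,\bar p(\cdot\mid x_{k-1},u_k)}\ln\big(\bar p(x_k\mid x_{k-1},u_k)\exp(\bar c(x_k))/q(x_k\mid x_{k-1},u_k)\big)$, and let $\tilde V_\alpha=V_\alpha$ for $\alpha>0$, $\tilde V_0=M(x_{k-1},u_k)$. Then for each $(x_{k-1},u_k)$: (1) $\lim_{\alpha\to\infty}V_\alpha(x_{k-1},u_k)=+\infty$, and $V_\alpha(x_{k-1},u_k)>0$ for every $\alpha>0$; (2) (i) if there is a constant $C$ such that $\bar p(x_k\mid x_{k-1},u_k)\exp(\bar c(x_k))/q(x_k\mid x_{k-1},u_k)=C$, then $\alpha\mapsto V_\alpha(x_{k-1},u_k)$ is linear and equal to $\ln C+\eta_k(x_{k-1},u_k)\alpha$; (ii) otherwise $\alpha\mapsto V_\alpha(x_{k-1},u_k)$ is strictly convex on $(0,+\infty)$; (3) $\lim_{\alpha\to0}V_\alpha(x_{k-1},u_k)=M(x_{k-1},u_k)$; (4) $\alpha\mapsto\tilde V_\alpha(x_{k-1},u_k)$ has a global minimum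 on $[0,+\infty)$.
   Context: State space $\mathcal{X}\subseteq\mathbb{K}^n$, action space $\mathcal{U}\subseteq\mathbb{K}^p$, $\mathbb{K}\in\{\mathbb{R},\mathbb{Z}\}$ (pdfs or pmfs). For each $(x_{k-1},u_k)$: $\bar p(x_k\mid x_{k-1},u_k)$ is a given nominal model, $q(x_k\mid x_{k-1},u_k)$ a given generative model, $\eta_k(x_{k-1},u_k)>0$ an ambiguity radius uniformly bounded by a finite constant. Standing assumptions: the environment transition density and $q(x_k\mid x_{k-1},u_k)$ are bounded and $\mathrm{supp}\,\bar p\subseteq\mathrm{supp}\,q$; $\bar c:\mathcal{X}\to\mathbb{R}$ is non-negative and bounded.
   Formalization: The expectation defining V_α is assumed finite for every α>0 (otherwise V_α=+∞ and (2)(ii) fails); the limsup defining M is taken as the essential supremum over supp p̄, and ''ratio = C'' (and its negation) is meant almost everywhere on supp p̄. *)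

(* Defs.v *)
From HB Require Import structures.
From mathcomp Require Import all_boot all_order all_algebra.
From mathcomp Require Import all_classical all_reals all_analysis ess_sup_inf.
Set Implicit Arguments. Unset Strict Implicit. Unset Printing Implicit Defensive.
Import Order.TTheory GRing.Theory Num.Theory.
Import numFieldNormedType.Exports.
Local Open Scope classical_set_scope.
Local Open Scope ring_scope.

(* All objects below are for a FIXED pair (x_{k-1}, u_k): pbar, q are the
   densities y |-> pbar(y | x_{k-1}, u_k), y |-> q(y | x_{k-1}, u_k) with
   respect to the reference measure mu (Lebesgue for pdfs, counting for pmfs),
   cbar is the state cost and eta = eta_k(x_{k-1}, u_k). *)

Definition cost_ratio {T : Type} {R : realType} (pbar q cbar : T -> R) (y : T) : R :=
  pbar y * expR (cbar y) / q y.

Definition Eterm {d} {T : measurableType d} {R : realType}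
  (mu : {measure set T -> \bar R}) (pbar q cbar : T -> R) (alpha : R) : \bar R :=
  (\int[mu]_y (pbar y * powR (pbar y / q y) alpha^-1 * expR (cbar y / alpha))%:E)%E.

Definition Valpha {d} {T : measurableType d} {R : realType}
  (mu : {measure set T -> \bar R}) (pbar q cbar : T -> R) (eta : R) (alpha : R) : R :=
  alpha * ln (fine (Eterm mu pbar q cbar alpha)) + alpha * eta.

(* M = limsup over supp pbar of ln(pbar exp(cbar)/q), read as the essential
   supremum (w.r.t. mu) of ln(cost_ratio) over supp pbar = {y | pbar y > 0};
   outside supp pbar the function is set to -oo so it does not contribute. *)
Definition Mval {d} {T : measurableType d} {R : realType}
  (mu : {measure set T -> \bar R}) (pbar q cbar : T -> R) : \bar R :=
  ess_sup mu (fun y => if 0 < pbar y then (ln (cost_ratio pbar q cbar y))%:E else -oo%E).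

Definition Vtilde {d} {T : measurableType d} {R : realType}
  (mu : {measure set T -> \bar R}) (pbar q cbar : T -> R) (eta : R) (alpha : R) : \bar R :=
  if alpha == 0 then Mval mu pbar q cbar else (Valpha mu pbar q cbar eta alpha)%:E.

(* Main.v *)
Require Import Defs.
From HB Require Import structures.
From mathcomp Require Import all_boot all_order all_algebra.
From mathcomp Require Import all_classical all_reals all_analysis ess_sup_inf.
From mathcomp Require Import measurable_realfun ring lra.
Set Implicit Arguments.
Unset Strict Implicit.
Import Order.TTheory GRing.Theory Num.Theory.
Import numFieldNormedType.Exports.
Local Open Scope classical_set_scope.
Local Open Scope ring_scope.

(** Put [L = ln (p e^c / q)] on the support of [p], so that
    [V_a = a ln E_p[e^(L/a)] + a eta].
    (1) From [e^(sL) >= 1 + sL] and [L >= 1 - e^(-L) >= 1 - q/p] one gets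
    [E_p[e^(sL)] >= 1], hence [V_a >= a eta].
    (2) [s |-> ln E_p[e^(sL)]] is strictly convex unless [L] is constant: the
    exponential is strictly convex, so the equality case of Hoelder's inequality
    forces [(s1 - s2) L] to be a.e. constant; [a |-> a ln E_p[e^(L/a)]] is its
    perspective.
    (3) [E_p[e^(L/a)] <= e^(m/a)] when [m] bounds [L] essentially, and
    [E_p[e^(L/a)] >= e^(l/a) P(L > l)] with [P(L > l) > 0] for [l] below the
    essential supremum.
    (4) [V] is continuous by dominated convergence; either [M] is below all the
    values [V_a], or the values below [M] are confined to a compact interval. *)

(** * Strict convexity of the exponential and strict positivity of integrals *)

Lemma expR_tangent_lt {R : realType} (m u : R) :
  u != m -> expR m * (1 + (u - m)) < expR u.
Proof.
move=> um; have -> : u = m + (u - m) by ring.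
rewrite expRD addrAC subrr add0r ltr_pM2l ?expR_gt0//.
by apply: expR_gt1Dx; rewrite subr_eq0.
Qed.

(** Both endpoints lie strictly above the tangent at the barycentre [m], and the linear terms of the
    two tangents cancel in the weighted sum. *)
Lemma expR_strictly_convex {R : realType} (k u v : R) : 0 < k < 1 -> u != v ->
  expR (k * u + (1 - k) * v) < k * expR u + (1 - k) * expR v.
Proof.
move=> /andP[k0 k1] uv; set m := k * u + _.
have um : u != m.
  apply: contra_neq uv => um; apply/eqP; rewrite -subr_eq0.
  have : (1 - k) * (u - v) = 0 by move: um; rewrite /m; lra.
  by move/eqP; rewrite mulf_eq0 gt_eqF ?subr_gt0//=.
have vm : v != m.
  apply: contra_neq uv => vm; apply/eqP; rewrite -subr_eq0.
  have : k * (u - v) = 0 by move: vm; rewrite /m; lra.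
  by move/eqP; rewrite mulf_eq0 gt_eqF//=.
have -> : expR m = k * (expR m * (1 + (u - m))) + (1 - k) * (expR m * (1 + (v - m))).
  by rewrite [in RHS]/m; ring.
by apply: ltrD; rewrite ltr_pM2l ?subr_gt0//; exact: expR_tangent_lt.
Qed.

Lemma Rintegral_gt0 {d} {T : measurableType d} {R : realType}
    (mu : {measure set T -> \bar R}) (f : T -> R) :
  mu.-integrable setT (EFin \o f) -> (forall y, 0 <= f y) ->
  ~ {ae mu, forall y, f y = 0} -> 0 < \int[mu]_y f y.
Proof.
move=> intf f0 nf; rewrite lt_neqAle Rintegral_ge0// andbT eq_sym.
apply/eqP => If; apply: nf.
have [+ _] := ae_eq_integral_abs mu measurableT (measurable_int mu intf).
have -> : (\int[mu]_x `|(EFin \o f) x|)%E = (\int[mu]_x (f x)%:E)%E.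
  by apply: eq_integral => y _; rewrite /= ger0_norm.
rewrite -[X in X = _ -> _]fineK; last exact: integrable_fin_num.
rewrite -/(Rintegral mu setT f) If => /(_ erefl).
by apply: filterS => y /(_ I) /= [].
Qed.

(** * Attaining a minimum on the closed half-line *)

Section positive_halfline_minimum.
Context {R : realType} (f : R -> R) (M : \bar R).
Hypothesis cf : forall a : R, 0 < a -> {for a, continuous f}.
Hypothesis f_infty : f a @[a --> +oo] --> +oo.
Hypothesis f_0 : (f a)%:E @[a --> 0^'+] --> M.

(** If no value of [f] lies below [M], the point 0 is a minimiser. Otherwise fix [b] with [f b < M]:
    the two limits keep [f] at least [f b] outside a compact interval containing [b], where the
    extreme value theorem applies. *)
Lemma cvg_halfline_min : exists a0 : R, 0 <= a0 /\ forall a : R, 0 <= a ->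
  ((if (a0 == 0)%R then M else (f a0)%:E) <=
   (if (a == 0)%R then M else (f a)%:E))%E.
Proof.
have [[b [b0 fbM]]|nb] := pselect (exists b, 0 < b /\ ((f b)%:E < M)%E); last first.
  exists 0; split => // a a0; rewrite eqxx; case: eqVneq => // an0.
  rewrite leNgt; apply/negP => faM; apply: nb; exists a; split => //.
  by rewrite lt_def an0.
have [h h0 hf] : exists2 h, 0 < h & forall a, 0 < a -> a < h -> f b < f a.
  have : \forall a \near 0^'+, ((f b)%:E < (f a)%:E)%E.
    exact: f_0 _ (open_ereal_gt' fbM).
  case=> h /= h0 hP; exists h => // a a0 ah; rewrite -lte_fin.
  by apply: hP => //=; rewrite sub0r normrN gtr0_norm.
have [N bN NP] : exists2 N, b <= N & forall a, N < a -> f b <= f a.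
  move/cvgryPge : f_infty => /(_ (f b)) [N [_ NP]].
  (* The maximum keeps [b] inside the interval on which [f] is minimised. *)
  exists (Num.max b N); first by rewrite le_max lexx.
  by move=> a; rewrite gt_max => /andP[_ Na]; exact: NP.
have h'b : Num.min h b <= N by rewrite ge_min bN orbT.
have h'0 : 0 < Num.min h b by rewrite lt_min h0.
have [|c] := EVT_min (f := f) h'b.
  apply: continuous_in_subspaceT => a; rewrite inE/= in_itv/= => /andP[ha _].
  exact: cf (lt_le_trans h'0 ha).
move=> hcE; rewrite in_itv/= in hcE; case/andP: hcE => hc cN cmin.
have c0 : 0 < c := lt_le_trans h'0 hc.
have cb : f c <= f b by apply: cmin; rewrite in_itv/= bN ge_min lexx orbT.
exists c; split; first exact: ltW.
move=> a a0; rewrite gt_eqF//; case: eqVneq => [_|an0].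
  by rewrite (le_trans _ (ltW fbM))// lee_fin.
have {an0}a0 : 0 < a by rewrite lt_def an0.
rewrite lee_fin; have [ah|ah] := ltP a (Num.min h b).
  apply: (le_trans cb); apply/ltW/hf => //.
  by apply: (lt_le_trans ah); rewrite ge_min lexx.
have [aN|Na] := leP a N; first by apply: cmin; rewrite in_itv/= ah.
exact: le_trans cb (NP _ Na).
Qed.

End positive_halfline_minimum.

(** * Exponential moments under a probability density *)

Section exponential_moments.
Context {d} {T : measurableType d} {R : realType}.
Variables (mu : {measure set T -> \bar R}) (p L : T -> R).

Definition mgf (s : R) : R := \int[mu]_y (p y * expR (s * L y)).

(** This is the entropic risk of [L] under [p], with risk aversion [1/a]. *)
Definition risk (a : R) : R := a * ln (mgf a^-1).

Definition supp_ess_sup : \bar R :=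
  ess_sup mu (fun y => if 0 < p y then (L y)%:E else -oo%E).

Hypothesis mL : measurable_fun setT L.
Hypothesis p_ge0 : forall y, 0 <= p y.
Hypothesis int_p : mu.-integrable setT (EFin \o p).
Hypothesis p1 : \int[mu]_y p y = 1.
Hypothesis int_mgf : forall s, 0 < s ->
  mu.-integrable setT (EFin \o (fun y => p y * expR (s * L y))).

Lemma density_not_ae0 : ~ {ae mu, forall y, p y = 0}.
Proof.
move=> p0; have : \int[mu]_y p y = 0; last by rewrite p1 => /eqP; rewrite oner_eq0.
rewrite /Rintegral (@ae_eq_integral _ _ _ mu setT (cst 0%E))//; last 2 first.
- exact: measurable_int int_p.
- by apply: filterS p0 => y /= ->.
by rewrite integral0.
Qed.

Lemma mgf_gt0 s : 0 < s -> 0 < mgf s.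
Proof.
move=> s0; apply: Rintegral_gt0; first exact: int_mgf.
- by move=> y; rewrite mulr_ge0// expR_ge0.
- move=> e0; apply: density_not_ae0; apply: filterS e0 => y /eqP.
  by rewrite mulf_eq0 [_ == 0 :> R in X in _ || X]gt_eqF ?expR_gt0// orbF => /eqP.
Qed.

(** Integrate [p e^(sL) >= p + s p L >= p + s (p - q)], where [p] and [q] have the same mass.
    Passing from [p L] to [p - q] gives an integrable minorant. *)
Lemma mgf_ge1 (q : T -> R) s : mu.-integrable setT (EFin \o q) ->
  \int[mu]_y q y = 1 -> (forall y, p y * (1 - L y) <= q y) ->
  0 < s -> 1 <= mgf s.
Proof.
move=> int_q q1 pLq s0.
have iZ f : mu.-integrable setT (EFin \o f) ->
    mu.-integrable setT (EFin \o (fun y => s * f y)).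
  by move=> fi; exact: (integrableZl measurableT s fi).
have i2 : mu.-integrable setT (EFin \o (fun y => s * p y - s * q y)).
  exact: (integrableB measurableT (iZ _ int_p) (iZ _ int_q)).
have -> : 1 = \int[mu]_y (p y + (s * p y - s * q y)) :> R.
  by rewrite RintegralD// RintegralB ?iZ// !RintegralZl// p1 q1 subrr addr0.
apply: le_Rintegral => //.
- exact: (integrableD measurableT int_p i2).
- exact: int_mgf.
- move=> y _; apply: (@le_trans _ _ (p y * (1 + s * L y))).
    have := ler_wpM2l (ltW s0) (pLq y); lra.
  by rewrite ler_wpM2l// expR_ge1Dx.
Qed.

Lemma risk_ge0 (q : T -> R) a : mu.-integrable setT (EFin \o q) ->
  \int[mu]_y q y = 1 -> (forall y, p y * (1 - L y) <= q y) ->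
  0 < a -> 0 <= risk a.
Proof.
move=> int_q q1 pLq a0; rewrite mulr_ge0 ?(ltW a0)// ln_ge0//.
by rewrite (mgf_ge1 int_q)// invr_gt0.
Qed.

Lemma mgf_ae_cst m s : {ae mu, forall y, 0 < p y -> L y = m} -> 0 < s ->
  mgf s = expR (s * m).
Proof.
move=> Lm s0; transitivity (\int[mu]_y (p y * expR (s * m))); last first.
  by rewrite RintegralZr// p1 mul1r.
rewrite /mgf /Rintegral; congr fine; apply: ae_eq_integral => //.
- exact: measurable_int (int_mgf s0).
- exact: measurable_int (integrableZr measurableT _ int_p).
- apply: filterS Lm => y Lm _ /=; have := p_ge0 y.
  by rewrite le_eqVlt => /predU1P[<-|/Lm->]//; rewrite !mul0r.
Qed.

Lemma risk_ae_cst m a : {ae mu, forall y, 0 < p y -> L y = m} -> 0 < a ->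
  risk a = m.
Proof.
move=> Lm a0; rewrite /risk (mgf_ae_cst Lm) ?invr_gt0// expRK.
by rewrite mulVKf// gt_eqF.
Qed.

(** * Strict log-convexity and its perspective *)

Lemma mgf_strictly_log_convex k s1 s2 : 0 < k < 1 -> 0 < s1 -> 0 < s2 ->
  s1 != s2 -> ~ (exists m, {ae mu, forall y, 0 < p y -> L y = m}) ->
  ln (mgf (k * s1 + (1 - k) * s2)) < k * ln (mgf s1) + (1 - k) * ln (mgf s2).
Proof.
move=> /andP[k0 k1] s10 s20 s12 ncst.
set A := mgf s1; set B := mgf s2; set s := k * s1 + _; set w := k * ln A + _.
have s0 : 0 < s by rewrite addr_gt0// mulr_gt0// subr_gt0.
have A0 : 0 < A by exact: mgf_gt0.
have B0 : 0 < B by exact: mgf_gt0.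
(* The integrals of [h1] and [h2] are [k] and [1 - k], while that of [h3] is [mgf s / e^w]; a
   positive integral of [h1 + h2 - h3] thus says [mgf s < e^w]. *)
pose h1 y := k / A * (p y * expR (s1 * L y)).
pose h2 y := (1 - k) / B * (p y * expR (s2 * L y)).
pose h3 y := expR (- w) * (p y * expR (s * L y)).
have i1 : mu.-integrable setT (EFin \o h1).
  exact: (integrableZl measurableT _ (int_mgf s10)).
have i2 : mu.-integrable setT (EFin \o h2).
  exact: (integrableZl measurableT _ (int_mgf s20)).
have i3 : mu.-integrable setT (EFin \o h3).
  exact: (integrableZl measurableT _ (int_mgf s0)).
have i12 : mu.-integrable setT (EFin \o (fun y => h1 y + h2 y)).
  exact: (integrableD measurableT i1 i2).
have hE y : h1 y + h2 y - h3 y = p y *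
    (k * expR (s1 * L y - ln A) + (1 - k) * expR (s2 * L y - ln B) -
     expR (k * (s1 * L y - ln A) + (1 - k) * (s2 * L y - ln B))).
  have -> : k * (s1 * L y - ln A) + (1 - k) * (s2 * L y - ln B) = - w + s * L y.
    by rewrite /w /s; ring.
  rewrite [expR (- w + _)]expRD !expRB !lnK ?posrE//.
  by rewrite /h1 /h2 /h3; ring.
have hlt y : s1 * L y - ln A != s2 * L y - ln B ->
    0 < k * expR (s1 * L y - ln A) + (1 - k) * expR (s2 * L y - ln B) -
     expR (k * (s1 * L y - ln A) + (1 - k) * (s2 * L y - ln B)).
  by move=> ne; rewrite subr_gt0 expR_strictly_convex// k0.
have : 0 < \int[mu]_y (h1 y + h2 y - h3 y).
  apply: Rintegral_gt0.
  - exact: (integrableB measurableT i12 i3).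
  - move=> y; rewrite hE mulr_ge0//.
    have [->|/hlt/ltW//] := eqVneq (s1 * L y - ln A) (s2 * L y - ln B).
    by rewrite le_eqVlt; apply/orP; left; apply/eqP; rewrite -!mulrDl !subrKC !mul1r subrr.
  (* Equality forces [s1 L - ln A = s2 L - ln B]; the witness is its solution in [L]. *)
  - move=> h0; apply: ncst; exists ((ln A - ln B) / (s1 - s2)).
    apply: filterS h0 => y /[swap] py /eqP; rewrite hE mulf_eq0 gt_eqF//= => e0.
    have /eqP : s1 * L y - ln A == s2 * L y - ln B.
      by apply/negPn/negP => /hlt; rewrite (eqP e0) ltxx.
    move=> e; have s120 : s1 - s2 != 0 by rewrite subr_eq0.
    apply: (mulIf s120); rewrite divfK//.
    by rewrite -[RHS]add0r -(subrr (s2 * L y - ln B)) -{1}e; ring.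
rewrite RintegralB// RintegralD// !RintegralZl//; try exact: int_mgf.
rewrite -/(mgf s1) -/(mgf s2) -/(mgf s) -/A -/B divfK ?gt_eqF// divfK ?gt_eqF//.
rewrite subrKC subr_gt0 expRN mulrC ltr_pdivrMr ?expR_gt0// mul1r => lt_w.
by rewrite -(expRK w) ltr_ln// posrE ?expR_gt0// mgf_gt0.
Qed.

Lemma risk_strictly_convex a b t : 0 < a -> 0 < b -> a != b -> 0 < t < 1 ->
  ~ (exists m, {ae mu, forall y, 0 < p y -> L y = m}) ->
  risk (t * a + (1 - t) * b) < t * risk a + (1 - t) * risk b.
Proof.
move=> a0 b0 ab /andP[t0 t1] ncst; set c := t * a + _.
have ta : 0 < t * a by rewrite mulr_gt0.
have tb : 0 < (1 - t) * b by rewrite mulr_gt0// subr_gt0.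
have c0 : 0 < c by rewrite addr_gt0.
(* With weight [t a / c] the combination of [1/a] and [1/b] is [1/c], and multiplying by [c]
   restores the factors [t a] and [(1 - t) b]. *)
have k01 : 0 < t * a / c < 1.
  by rewrite divr_gt0//= ltr_pdivrMr// mul1r ltrDl.
have kE : 1 - t * a / c = (1 - t) * b / c.
  by rewrite -{1}(divff (lt0r_neq0 c0)) -mulrBl /c addrAC subrr add0r.
have := mgf_strictly_log_convex k01 (s1 := a^-1) (s2 := b^-1).
rewrite !invr_gt0 => /(_ a0 b0).
rewrite (inj_eq invr_inj) => /(_ ab ncst); rewrite kE.
have -> : t * a / c / a + (1 - t) * b / c / b = c^-1.
  by field; rewrite !gt_eqF.
rewrite -(ltr_pM2l c0) => /lt_le_trans; apply.
rewrite le_eqVlt; apply/orP; left; apply/eqP.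
rewrite /risk; field.
by rewrite gt_eqF.
Qed.

(** * Continuity in the parameter *)

Lemma mgf_continuous s : 0 < s -> {for s, continuous mgf}.
Proof.
move=> s0; have s20 : 0 < s / 2 by rewrite divr_gt0.
have ss0 : 0 < s * 2 by rewrite mulr_gt0.
(* For [t] between [s/2] and [2s], [e^(tL)] is bounded by its value at [2s] where [L >= 0] and at
   [s/2] where [L < 0]; the sum covers both signs. *)
pose g y := p y * expR (s / 2 * L y) + p y * expR (s * 2 * L y).
apply: (@continuity_under_integral _ _ _ mu
  (fun t y => p y * expR (t * L y)) setT measurableT (s / 2) (s * 2) _ _ g).
- move=> t; rewrite /= in_itv/= => /andP[st _].
  exact: int_mgf (lt_trans s20 st).
- apply: aeW => y _ t _; apply: cvgM; first exact: cvg_cst.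
  apply: continuous_cvg; first exact: continuous_expR.
  by apply: cvgM; [exact: cvg_id|exact: cvg_cst].
- exact: (integrableD measurableT (int_mgf s20) (int_mgf ss0)).
- move=> t; rewrite /= in_itv/= => /andP[st ts]; apply: aeW => y _.
  rewrite ger0_norm ?mulr_ge0 ?expR_ge0// /g -mulrDr ler_wpM2l//.
  have [L0|L0] := leP 0 (L y).
    rewrite (@le_trans _ _ (expR (s * 2 * L y)))// ?lerDr ?expR_ge0//.
    by rewrite ler_expR ler_wpM2r// ltW.
  rewrite (@le_trans _ _ (expR (s / 2 * L y)))// ?lerDl ?expR_ge0//.
  by rewrite ler_expR ler_wnM2r// ltW.
- by rewrite inE/= in_itv/=; lra.
Qed.

Lemma risk_continuous a : 0 < a -> {for a, continuous risk}.
Proof.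
move=> a0; apply: cvgM; first exact: cvg_id.
have ai : 0 < a^-1 by rewrite invr_gt0.
apply: continuous_cvg; first exact: continuous_ln (mgf_gt0 ai).
apply: continuous_cvg; first exact: mgf_continuous.
by apply: inv_continuous; rewrite gt_eqF.
Qed.

(** * Limit of the risk at 0 *)

Lemma supp_ess_sup_gtNy : (-oo < supp_ess_sup)%E.
Proof.
rewrite ltNye; apply/eqP => /ess_sup_eqNyP Ny; apply: density_not_ae0.
apply: filterS Ny => y /=; have := p_ge0 y.
by rewrite le_eqVlt => /predU1P[//|->].
Qed.

Lemma risk_le_ess_sup m a : (supp_ess_sup <= m%:E)%E -> 0 < a -> risk a <= m.
Proof.
move=> /ess_supP Lm a0; have ai : 0 < a^-1 by rewrite invr_gt0.
rewrite /risk -ler_pdivlMl// -(expRK (a^-1 * m)) ler_ln ?posrE ?expR_gt0 ?mgf_gt0//.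
have -> : expR (a^-1 * m) = \int[mu]_y (p y * expR (a^-1 * m)).
  by rewrite RintegralZr// p1 mul1r.
rewrite fine_le ?integrable_fin_num//; first exact: int_mgf.
  exact: (integrableZr measurableT _ int_p).
apply: ae_ge0_le_integral => //.
- by move=> y _; rewrite lee_fin mulr_ge0// expR_ge0.
- exact: measurable_int (int_mgf ai).
- by move=> y _; rewrite lee_fin mulr_ge0// expR_ge0.
- exact: measurable_int (integrableZr measurableT _ int_p).
apply: filterS Lm => y Lm _; rewrite lee_fin; have := p_ge0 y.
rewrite le_eqVlt => /predU1P[<-|py]; first by rewrite !mul0r.
by move: Lm; rewrite py lee_fin => Lm; rewrite ler_pM2l// ler_expR ler_pM2l.
Qed.

Lemma risk_ge_below_ess_sup l : (l%:E < supp_ess_sup)%E ->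
  exists2 e : R, 0 < e & forall a, 0 < a -> a * ln e + l <= risk a.
Proof.
move=> lM; pose A := [set y | l < L y].
have mA : measurable A.
  rewrite [A](_ : _ = setT `&` L @^-1` `]l, +oo[); first exact: mL.
  by apply/seteqP; split => y /=; rewrite in_itv/= andbT// => -[].
pose pA y := p y * \1_A y.
have pA_ge0 y : 0 <= pA y by rewrite mulr_ge0.
have mp : measurable_fun setT p.
  by apply/measurable_EFinP; exact: measurable_int int_p.
have int_pA : mu.-integrable setT (EFin \o pA).
  apply: (le_integrable measurableT _ _ int_p).
    apply/measurable_EFinP; apply: measurable_funM => //.
  move=> y _ /=; rewrite lee_fin !ger0_norm// /pA indicE.
  by case: (y \in A); rewrite ?mulr1 ?mulr0.
(* This is the probability of [L > l] under [p]; were it zero, [l] would bound [L] essentially on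
   the support. *)
set e := \int[mu]_y pA y.
have e0 : 0 < e.
  apply: Rintegral_gt0 => // pA0.
  suff : (supp_ess_sup <= l%:E)%E by rewrite leNgt lM.
  apply/ess_supP; apply: filterS pA0 => y; rewrite /pA.
  case: ifPn => [py /eqP|_ _]; last by rewrite leNye.
  rewrite mulf_eq0 gt_eqF//= indicE pnatr_eq0 eqb0 notin_setE /A /= => /negP.
  by rewrite -leNgt lee_fin.
exists e => // a a0.
have ai : 0 < a^-1 by rewrite invr_gt0.
(* A Markov-type bound: [e^(L/a)] exceeds [e^(l/a)] on [A]. Taking logarithms and multiplying by [a]
   gives the claim. *)
suff : expR (a^-1 * l) * e <= mgf a^-1.
  rewrite -ler_ln ?posrE ?mulr_gt0 ?expR_gt0 ?mgf_gt0//.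
  rewrite lnM ?posrE ?expR_gt0// expRK -(ler_pM2l a0) mulrDr mulVKf ?gt_eqF//.
  by rewrite addrC.
rewrite /e -RintegralZl//; apply: le_Rintegral => //.
- exact: (integrableZl measurableT _ int_pA).
- exact: int_mgf.
move=> y _; rewrite /pA indicE mulrCA ler_wpM2l//.
case: (boolP (y \in A)) => [|_]; last by rewrite mulr0 expR_ge0.
by rewrite inE /A /= mulr1 ler_expR ler_pM2l// => /ltW.
Qed.

Lemma risk_cvg0 : (risk a)%:E @[a --> 0^'+] --> supp_ess_sup.
Proof.
(* The correction [a ln dl] tends to 0 with [a], hence eventually exceeds [-e]. *)
have lower l e : (l%:E < supp_ess_sup)%E -> 0 < e ->
    \forall a \near 0^'+, l - e <= risk a.
  move=> lM e0; have [dl dl0 dlP] := risk_ge_below_ess_sup lM.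
  have : a * ln dl @[a --> 0^'+] --> (0 * ln dl : R).
    apply: cvg_at_right_filter.
    by apply: cvgM; [exact: cvg_id|exact: cvg_cst].
  rewrite mul0r => /cvgr_gt /(_ (- e)); rewrite oppr_lt0 => /(_ e0) near0.
  near=> a; have a0 : 0 < a by near: a; exact: nbhs_right_gt.
  apply: le_trans (dlP a a0); rewrite addrC lerD2r ltW//.
  by near: a; exact: near0.
have := supp_ess_sup_gtNy; case E : supp_ess_sup => [m| |]// _.
- apply/cvg_EFin; first by near=> a.
  apply/cvgrPdist_le => e e0.
  (* One half of [e] places [l = m - e/2] below the supremum; the other absorbs the vanishing
     correction. *)
  have e20 : 0 < e / 2 by rewrite divr_gt0.
  near=> a; have a0 : 0 < a by near: a; exact: nbhs_right_gt.
  have am : risk a <= m by apply: risk_le_ess_sup => //; rewrite E.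
  have ma : m - e / 2 - e / 2 <= risk a.
    near: a; apply: lower => //.
    by rewrite E lte_fin ltrBlDr ltrDl.
  by rewrite /= ger0_norm ?subr_ge0//; lra.
(* Writing [A] as [(A + 1) - 1] fits [lower] with [l = A + 1] and slack 1. *)
- apply/cvgeyPge => A; near=> a; rewrite lee_fin -(addrK 1 A).
  by near: a; apply: lower; rewrite ?E ?ltry.
Unshelve. all: by end_near. Qed.
End exponential_moments.

(** * Reduction of the value function to the log-ratio *)

Section log_cost_ratio.
Context {d} {T : measurableType d} {R : realType}.
Variables (mu : {measure set T -> \bar R}) (p q c : T -> R).

(* Splitting the logarithm of the ratio makes measurability immediate; it agrees
   with [ln (cost_ratio p q c y)] only on the support of [p]. *)
Definition log_ratio (y : T) : R := ln (p y) - ln (q y) + c y.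

Hypothesis p_ge0 : forall y, 0 <= p y.
Hypothesis pq : forall y, 0 < p y -> 0 < q y.

Lemma cost_ratioE y : 0 < p y -> cost_ratio p q c y = expR (log_ratio y).
Proof.
move=> py; rewrite expRD expRB !lnK ?posrE ?pq// /cost_ratio.
by rewrite mulrAC.
Qed.

(** Off the support both sides carry the factor [p y = 0], so the identity holds at every point. *)
Lemma Eterm_integrandE a y :
  p y * powR (p y / q y) a^-1 * expR (c y / a) =
  p y * expR (a^-1 * log_ratio y).
Proof.
have := p_ge0 y; rewrite le_eqVlt => /predU1P[<-|py]; first by rewrite !mul0r.
rewrite -mulrA; congr (_ * _).
rewrite /powR gt_eqF ?divr_gt0 ?pq// -expRD; congr expR.
by rewrite ln_div ?posrE ?pq// /log_ratio [in RHS]mulrDr [c y / a]mulrC.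
Qed.

Lemma EtermE a : fine (Eterm mu p q c a) = mgf mu p log_ratio a^-1.
Proof. by apply: eq_Rintegral => y _; exact: Eterm_integrandE. Qed.

Lemma ValphaE eta a : Valpha mu p q c eta a = risk mu p log_ratio a + a * eta.
Proof. by rewrite /Valpha EtermE. Qed.

Lemma MvalE : Mval mu p q c = supp_ess_sup mu p log_ratio.
Proof.
apply: eq_ess_sup; apply: aeW => y; case: ifP => // py.
by rewrite cost_ratioE// expRK.
Qed.

(** On the support, [1 - L <= e^(-L) = q e^(-c) / p], which is at most [q / p] since [c >= 0]. *)
Lemma density_log_ratio_le y : 0 <= q y -> 0 <= c y ->
  p y * (1 - log_ratio y) <= q y.
Proof.
move=> q0 cy; have := p_ge0 y; rewrite le_eqVlt => /predU1P[<-|py].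
  by rewrite mul0r.
apply: (@le_trans _ _ (p y * expR (- log_ratio y))).
  by rewrite ler_wpM2l// expR_ge1Dx.
have -> : p y * expR (- log_ratio y) = q y * expR (- c y).
  rewrite !expRN expRD expRB !lnK ?posrE ?pq//; field.
  by rewrite !gt_eqF ?expR_gt0 ?pq.
by rewrite ler_piMr// -expR0 ler_expR oppr_le0.
Qed.

End log_cost_ratio.

(** * The four claims for a fixed state and action *)

Unset Implicit Arguments.
Theorem theorem2 (d : measure_display) (X : measurableType d) (R : realType)
  (mu : {measure set X -> \bar R}) (U : Type)
  (pbar q : X -> U -> X -> R) (cbar : X -> R) (eta : X -> U -> R) :
  (* pbar(. | x,u) and q(. | x,u) are probability densities w.r.t. mu *)
  (forall x u, measurable_fun setT (pbar x u)) ->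
  (forall x u, measurable_fun setT (q x u)) ->
  (forall x u y, 0 <= pbar x u y) ->
  (forall x u y, 0 <= q x u y) ->
  (forall x u, (\int[mu]_y (pbar x u y)%:E = 1)%E) ->
  (forall x u, (\int[mu]_y (q x u y)%:E = 1)%E) ->
  (* q is bounded *)
  (exists B : R, forall x u y, q x u y <= B) ->
  (* supp pbar is contained in supp q *)
  (forall x u y, 0 < pbar x u y -> 0 < q x u y) ->
  (* cbar is non-negative, bounded, measurable *)
  measurable_fun setT cbar ->
  (forall y, 0 <= cbar y) ->
  (exists B : R, forall y, cbar y <= B) ->
  (* eta is positive and uniformly bounded *)
  (forall x u, 0 < eta x u) ->
  (exists B : R, forall x u, eta x u <= B) ->
  (* (implicit in the paper) the expectation defining V_alpha is finite *)
  (forall x u alpha, 0 < alpha ->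
     (Eterm mu (pbar x u) (q x u) cbar alpha < +oo)%E) ->
  forall x u,
  let V := Valpha mu (pbar x u) (q x u) cbar (eta x u) in
  let M := Mval mu (pbar x u) (q x u) cbar in
  let Vt := Vtilde mu (pbar x u) (q x u) cbar (eta x u) in
  let constant_ratio := exists C : R,
      {ae mu, forall y, 0 < pbar x u y -> cost_ratio (pbar x u) (q x u) cbar y = C} in
  (* (1) *)
  ((V a @[a --> +oo] --> +oo) /\ (forall a, 0 < a -> 0 < V a)) /\
  (* (2) *)
  ((forall C : R,
      {ae mu, forall y, 0 < pbar x u y -> cost_ratio (pbar x u) (q x u) cbar y = C} ->
      forall a, 0 < a -> V a = ln C + eta x u * a) /\
   (~ constant_ratio ->
      forall a b t, 0 < a -> 0 < b -> a != b -> 0 < t < 1 ->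
        V (t * a + (1 - t) * b) < t * V a + (1 - t) * V b)) /\
  (* (3) *)
  ((V a)%:E @[a --> 0^'+] --> M) /\
  (* (4) *)
  (exists a0, 0 <= a0 /\ forall a, 0 <= a -> (Vt a0 <= Vt a)%E).
Proof.
move=> mp mq p0 q0 p1 q1 _ pq mc c0 _ eta0 _ Efin x u V M Vt constant_ratio.
pose L := log_ratio (pbar x u) (q x u) cbar.
have mL : measurable_fun setT L.
  apply: measurable_funD => //; apply: measurable_funB.
    exact: measurableT_comp.
  exact: measurableT_comp.
have int1 (f : X -> R) : measurable_fun setT f -> (forall y, 0 <= f y) ->
    (\int[mu]_y (f y)%:E < +oo)%E -> mu.-integrable setT (EFin \o f).
  move=> mf f0 fy; apply/integrableP; split; first exact/measurable_EFinP.
  by under eq_integral do rewrite /= ger0_norm//.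
have int_p : mu.-integrable setT (EFin \o pbar x u).
  by apply: int1 => //; rewrite p1 ltry.
have int_q : mu.-integrable setT (EFin \o q x u).
  by apply: int1 => //; rewrite q1 ltry.
have Ip : \int[mu]_y pbar x u y = 1 by rewrite /Rintegral p1.
have Iq : \int[mu]_y q x u y = 1 by rewrite /Rintegral q1.
(* The moment at [s] is the expectation at [alpha = 1/s], finite by assumption. *)
have int_mgf s : 0 < s ->
    mu.-integrable setT (EFin \o (fun y => pbar x u y * expR (s * L y))).
  move=> s0; apply: int1.
  - apply: measurable_funM => //; apply: measurableT_comp => //.
    exact: measurable_funM.
  - by move=> y; rewrite mulr_ge0// expR_ge0.
  - have := Efin x u s^-1; rewrite invr_gt0 => /(_ s0); rewrite /Eterm.
    by under eq_integral do rewrite (Eterm_integrandE _ (p0 x u) (pq x u)) invrK.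
have VE a : V a = risk mu (pbar x u) L a + a * eta x u by apply: ValphaE => // y; exact: pq.
have ME : M = supp_ess_sup mu (pbar x u) L by apply: MvalE => // y; exact: pq.
(* This linear lower bound yields both positivity and the limit at infinity. *)
have V_ge a : 0 < a -> a * eta x u <= V a.
  move=> a0; rewrite VE lerDr.
  apply: (risk_ge0 (p0 x u) int_p Ip int_mgf int_q Iq) => // y.
  by apply: density_log_ratio_le => // z; exact: pq.
have V_infty : V a @[a --> +oo] --> +oo.
  apply/cvgryPge => A; near=> a.
  have a0 : 0 < a by near: a; exact: nbhs_pinfty_gt.
  by apply: le_trans (V_ge a a0); rewrite -ler_pdivrMr.
have V_0 : (V a)%:E @[a --> 0^'+] --> M.
  (* The limit is split as [M + 0]; the finite summand keeps the sum defined even when [M] is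
     infinite. *)
  rewrite ME -[supp_ess_sup _ _ _]adde0.
  under eq_fun do rewrite VE EFinD.
  apply: cvgeD; [by rewrite fin_num_adde_defl|exact: risk_cvg0|].
  apply/cvg_EFin; first by near=> a.
  rewrite -[X in _ --> X](mul0r (eta x u)); apply: cvg_at_right_filter.
  by apply: cvgM; [exact: cvg_id|exact: cvg_cst].
have cst_log C : {ae mu, forall y, 0 < pbar x u y ->
      cost_ratio (pbar x u) (q x u) cbar y = C} ->
    {ae mu, forall y, 0 < pbar x u y -> L y = ln C}.
  apply: filterS => y CE py; rewrite -(CE py) cost_ratioE ?expRK//.
  exact: pq.
split; first split => //.
  by move=> a a0; rewrite (lt_le_trans _ (V_ge a a0))// mulr_gt0.
split; first split.
- move=> C /cst_log LC a a0.
  by rewrite VE (risk_ae_cst (p0 x u) int_p Ip int_mgf LC a0) mulrC.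
- move=> ncst a b t a0 b0 ab t01; rewrite !VE.
  (* The term in [eta] is linear, so strictness must come from the risk; a constant log-ratio [m]
     would make the cost ratio the constant [e^m]. *)
  have : risk mu (pbar x u) L (t * a + (1 - t) * b) <
      t * risk mu (pbar x u) L a + (1 - t) * risk mu (pbar x u) L b.
    apply: risk_strictly_convex => // -[m Lm]; apply: ncst; exists (expR m).
    apply: filterS Lm => y Lm py; rewrite cost_ratioE//; last exact: pq.
    by rewrite -/L Lm.
  move: (risk _ _ _ _) (risk _ _ _ _) (risk _ _ _ _) => r1 r2 r3; clear; lra.
split => //.
apply: (cvg_halfline_min (f := V)) => // a a0.
have -> : V = (fun a => risk mu (pbar x u) L a + a * eta x u) by apply/funext.
apply: cvgD; first exact: risk_continuous.
by apply: cvgM; [exact: cvg_id|exact: cvg_cst].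
Unshelve. all: by end_near. Qed.
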